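(* Let $\boldsymbol{\lambda},\boldsymbol{\lambda}'\in\mathbb{C}^{\times}\times\mathbb{C}^{\times}$, $\boldsymbol{\beta},\boldsymbol{\beta}'\in\mathbb{C}\times\mathbb{C}$ and $b_{\mathbf 0},b_{\mathbf 0}',k,k'\in\mathbb{C}$. (1) $\Omega(\boldsymbol{\lambda},\boldsymbol{\beta},b_{\mathbf 0},k)\cong\Omega(\boldsymbol{\lambda}',\boldsymbol{\beta}',b_{\mathbf 0}',k')$ as $L(0,0)$-modules if and only if $\boldsymbol{\lambda}=\boldsymbol{\lambda}'$, $b_{\mathbf 0}=b_{\mathbf 0}'$ and $k=k'$. (2) $\Omega(\boldsymbol{\lambda},\boldsymbol{\beta},b_{\mathbf 0},k)\cong\Omega(\boldsymbol{\lambda}',\boldsymbol{\beta}',b_{\mathbf 0}',k')$ as $\widetilde{L}(0,0)$-modules if and only if $\boldsymbol{\lambda}=\boldsymbol{\lambda}'$, $\boldsymbol{\beta}=\boldsymbol{\beta}'$, $b_{\mathbf 0}=b_{\mathbf 0}'$ and $k=k'$.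
   Context: $\mathbb{C}^{\times}=\mathbb{C}\setminus\{0\}$. $L(0,0)$ is the complex Lie algebra spanned by $t^{\mathbf m},E(\mathbf m)$, $\mathbf m=(m_1,m_2)\in\mathbb{Z}^2$, with relations $[t^{\mathbf m},t^{\mathbf n}]=0$, $[t^{\mathbf m},E(\mathbf n)]=-|\mathbf m,\mathbf n|\,t^{\mathbf m+\mathbf n}$, $[E(\mathbf m),E(\mathbf n)]=-|\mathbf m,\mathbf n|\,E(\mathbf m+\mathbf n)$, where $|\mathbf m,\mathbf n|=m_1n_2-m_2n_1$. The Lie algebra $\widetilde{L}(0,0)$ is obtained from $L(0,0)$ by adjoining degree derivations $\partial_1,\partial_2$ with $[\partial_i,E(\mathbf m)]=m_iE(\mathbf m)$, $[\partial_i,t^{\mathbf m}]=m_it^{\mathbf m}$ ($i=1,2$), $[\partial_1,\partial_2]=0$. For $\boldsymbol{\lambda}=(\lambda_1,\lambda_2)\in\mathbb{C}^{\times}\times\mathbb{C}^{\times}$, $\boldsymbol{\beta}=(\beta_1,\beta_2)\in\mathbb{C}\times\mathbb{C}$, $b_{\mathbf 0},k\in\mathbb{C}$, the module $\Omega(\boldsymbol{\lambda},\boldsymbol{\beta},b_{\mathbf 0},k)$ is the polynomial space $\mathbb{C}[\partial_1,\partial_2]$ on which $\partial_1,\partial_2$ act by multiplication and, for $f\in\mathbb{C}[\partial_1,\partial_2]$, $E(\mathbf m)f(\partial_1,\partial_2)=\lambda_1^{m_1}\lambda_2^{m_2}(m_2(\partial_1+\beta_1)-m_1(\partial_2+\beta_2))f(\partial_1-m_1,\partial_2-m_2)$,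 $t^{\mathbf m}f(\partial_1,\partial_2)=\lambda_1^{m_1}\lambda_2^{m_2}k\,f(\partial_1-m_1,\partial_2-m_2)$ if $\mathbf m\neq\mathbf 0$, and $t^{\mathbf 0}f(\partial_1,\partial_2)=b_{\mathbf 0}f(\partial_1,\partial_2)$. It is regarded as an $L(0,0)$-module by restriction. *)

(* Defs.v *)
From HB Require Import structures.
From mathcomp Require Import all_boot all_order all_algebra.
From mathcomp Require Import finmap.
From mathcomp Require Import ring.
From mathcomp Require Import monalg.
From mathcomp Require Import mpoly.

Set Implicit Arguments.
Unset Strict Implicit.
Unset Printing Implicit Defensive.

Import GRing.Theory.
Local Open Scope ring_scope.

(** * Lie algebras and their modules *)

HB.mixin Record Lmodule_isLieAlgebra (K : fieldType) L of GRing.Lmodule K L := {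
  lie : L -> L -> L;
  lie_linearl : forall y : L, linear (lie^~ y);
  lie_linearr : forall x : L, linear (lie x);
  liexx : forall x : L, lie x x = 0;
  lie_jacobi : forall x y z : L,
    lie x (lie y z) + lie y (lie z x) + lie z (lie x y) = 0
}.

#[short(type="lieAlgType")]
HB.structure Definition LieAlgebra (K : fieldType) :=
  { L of Lmodule_isLieAlgebra K L & GRing.Lmodule K L }.

Definition lie_morphism (K : fieldType) (L1 L2 : lieAlgType K)
    (f : {linear L1 -> L2}) : Prop :=
  forall x y : L1, f (lie x y) = lie (f x) (f y).

Record lieModule (K : fieldType) (L : lieAlgType K) := LieModule {
  lieModule_sort :> lmodType K;
  lieact : L -> lieModule_sort -> lieModule_sort;
  lieact_linearl : forall v : lieModule_sort, linear (lieact^~ v);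
  lieact_linearr : forall x : L, linear (lieact x);
  lieact_lie : forall (x y : L) (v : lieModule_sort),
    lieact (lie x y) v = lieact x (lieact y v) - lieact y (lieact x v)
}.

Definition lieModule_iso (K : fieldType) (L : lieAlgType K)
    (M N : lieModule L) : Prop :=
  exists f : {linear M -> N},
    bijective f /\ forall (x : L) (v : M), f (lieact x v) = lieact x (f v).

Section Restriction.
Variables (K : fieldType) (L1 L2 : lieAlgType K) (f : {linear L1 -> L2}).
Hypothesis f_lie : lie_morphism f.
Variable M : lieModule L2.

Fact restr_linearl (v : M) : linear (fun x : L1 => lieact (f x) v).
Proof. by move=> a x y; rewrite linearP (lieact_linearl v a). Qed.

Fact restr_lie (x y : L1) (v : M) : lieact (f (lie x y)) v =
  lieact (f x) (lieact (f y) v) - lieact (f y) (lieact (f x) v).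
Proof. by rewrite f_lie lieact_lie. Qed.

Definition restr : lieModule L1 :=
  LieModule restr_linearl (fun x => lieact_linearr (f x)) restr_lie.

End Restriction.

(** * Linear extension from a basis *)

Section LinearExtension.
Variables (K : fieldType) (B : choiceType).

(* [{malg K[B]}] is used here only as the free K-module with basis
   [<< b >>], [b : B]. *)
Lemma malg_lind (P : {malg K[B]} -> Prop) :
  P 0 -> (forall x y, P x -> P y -> P (x + y)) ->
  (forall a x, P x -> P (a *: x)) -> (forall b, P << b >>) -> forall x, P x.
Proof.
move=> P0 PD PZ PB x; rewrite [x]monalg.monalgE.
elim/big_ind: _ => // b _.
suff -> : monalg.mkmalgU b (monalg.mcoeff b x) = monalg.mcoeff b x *: << b >>.
  exact: PZ.
by apply/monalg.malgP => c; rewrite monalg.mcoeffZ !monalg.mcoeffU mulrnAr mulr1.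
Qed.

Variable V : lmodType K.

Definition lext (f : B -> V) (x : {malg K[B]}) : V :=
  \sum_(b <- monalg.msupp x) monalg.mcoeff b x *: f b.

Variable f : B -> V.

Fact lextEw (x : {malg K[B]}) (D : {fset B}) :
  (monalg.msupp x `<=` D)%fset ->
  lext f x = \sum_(b <- D) monalg.mcoeff b x *: f b.
Proof.
move=> sD; apply: big_fset_incl => // b _.
by rewrite -monalg.mcoeff_eq0 => /eqP ->; rewrite scale0r.
Qed.

Fact lext_is_linear : linear (lext f).
Proof.
move=> a x y; pose S := @monalg.msupp B K.
pose D := (S (a *: x + y)%R `|` (S x `|` S y))%fset.
rewrite (@lextEw _ D) ?fsubsetUl // (@lextEw x D) ?(@lextEw y D); last 2 first.
- by apply/fsubsetP=> b by_; rewrite !in_fsetU by_ !orbT.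
- by apply/fsubsetP=> b bx; rewrite !in_fsetU bx !orbT.
rewrite scaler_sumr -big_split /=; apply: eq_bigr => b _.
by rewrite monalg.mcoeffD monalg.mcoeffZ scalerDl scalerA.
Qed.

HB.instance Definition _ :=
  GRing.isLinear.Build K {malg K[B]} V *:%R (lext f) lext_is_linear.

Fact lextB (b : B) : lext f << b >> = f b.
Proof.
by rewrite /lext monalg.msuppU oner_eq0 big_seq_fset1 monalg.mcoeffUU scale1r.
Qed.

End LinearExtension.

Fact lext_linearf (K : fieldType) (B : choiceType) (U V : lmodType K)
    (f : B -> U -> V) (x : {malg K[B]}) :
  (forall b, linear (f b)) -> linear (fun u => lext (f^~ u) x).
Proof.
move=> f_lin a u v; rewrite /lext scaler_sumr -big_split /=.
by apply: eq_bigr => b _; rewrite f_lin scalerDr !scalerA mulrC.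
Qed.

Section BilinearOnBasis.
Variables (K : fieldType) (B : choiceType).
Variable br : {malg K[B]} -> {malg K[B]} -> {malg K[B]}.
Hypothesis br_linearl : forall y, linear (br^~ y).
Hypothesis br_linearr : forall x, linear (br x).

Let brDl x1 x2 y : br (x1 + x2) y = br x1 y + br x2 y.
Proof. by have := br_linearl y 1 x1 x2; rewrite !scale1r. Qed.
Let brDr x y1 y2 : br x (y1 + y2) = br x y1 + br x y2.
Proof. by have := br_linearr x 1 y1 y2; rewrite !scale1r. Qed.
Let br0l y : br 0 y = 0.
Proof. by apply: (addrI (br 0 y)); rewrite -brDl !addr0. Qed.
Let br0r x : br x 0 = 0.
Proof. by apply: (addrI (br x 0)); rewrite -brDr !addr0. Qed.
Let brZl a x y : br (a *: x) y = a *: br x y.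
Proof. by have := br_linearl y a x 0; rewrite /= br0l !addr0. Qed.
Let brZr a x y : br x (a *: y) = a *: br x y.
Proof. by have := br_linearr x a y 0; rewrite /= br0r !addr0. Qed.

Hypothesis brBB : forall a, br << a >> << a >> = 0.
Hypothesis brBC : forall a b, br << a >> << b >> = - br << b >> << a >>.
Hypothesis brBJ : forall a b d, br << a >> (br << b >> << d >>)
  + br << b >> (br << d >> << a >>) + br << d >> (br << a >> << b >>) = 0.

Let brC x y : br x y = - br y x.
Proof.
elim/malg_lind: x => [|x1 x2 h1 h2|a x h|a].
- by rewrite br0l br0r oppr0.
- by rewrite brDl brDr h1 h2 opprD.
- by rewrite brZl brZr h scalerN.
elim/malg_lind: y => [|y1 y2 h1 h2|d y h|b].
- by rewrite br0l br0r oppr0.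
- by rewrite brDl brDr h1 h2 opprD.
- by rewrite brZl brZr h scalerN.
exact: brBC.
Qed.

Fact basis_lie_alternating x : br x x = 0.
Proof.
elim/malg_lind: x => [|x y hx hy|a x h|a].
- exact: br0l.
- by rewrite brDl !brDr hx hy add0r addr0 brC addNr.
- by rewrite brZl brZr h !scaler0.
- exact: brBB.
Qed.

Let add3ACA (V : zmodType) (u u' v v' w w' : V) :
  (u + u') + (v + v') + (w + w') = (u + v + w) + (u' + v' + w').
Proof. by rewrite (addrACA u) (addrACA (u + v)). Qed.

Fact basis_lie_jacobi x y z :
  br x (br y z) + br y (br z x) + br z (br x y) = 0.
Proof.
elim/malg_lind: x => [|x1 x2 h1 h2|a x h|a].
- by rewrite !(br0l, br0r, addr0).
- by rewrite !(brDl, brDr) add3ACA h1 h2 addr0.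
- by rewrite !(brZl, brZr) -!scalerDr h scaler0.
elim/malg_lind: y => [|x1 x2 h1 h2|d y h|b].
- by rewrite !(br0l, br0r, addr0).
- by rewrite !(brDl, brDr) add3ACA h1 h2 addr0.
- by rewrite !(brZl, brZr) -!scalerDr h scaler0.
elim/malg_lind: z => [|x1 x2 h1 h2|e z h|e].
- by rewrite !(br0l, br0r, addr0).
- by rewrite !(brDl, brDr) add3ACA h1 h2 addr0.
- by rewrite !(brZl, brZr) -!scalerDr h scaler0.
exact: brBJ.
Qed.

End BilinearOnBasis.

Section BasisBracket.
Variables (K : fieldType) (B : choiceType) (c : B -> B -> {malg K[B]}).

Definition blie (x y : {malg K[B]}) : {malg K[B]} :=
  lext (fun a => lext (c a) y) x.

Fact blieB a b : blie << a >> << b >> = c a b.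
Proof. by rewrite /blie !lextB. Qed.

Fact blie_linearl y : linear (blie^~ y).
Proof. exact: lext_is_linear. Qed.

Fact blie_linearr x : linear (blie x).
Proof.
apply: (lext_linearf (f := fun a => lext (c a))) => b; exact: lext_is_linear.
Qed.

Fact blieDl x1 x2 y : blie (x1 + x2) y = blie x1 y + blie x2 y.
Proof. by have := blie_linearl y 1 x1 x2; rewrite !scale1r. Qed.
Fact blieDr x y1 y2 : blie x (y1 + y2) = blie x y1 + blie x y2.
Proof. by have := blie_linearr x 1 y1 y2; rewrite !scale1r. Qed.
Fact blie0l y : blie 0 y = 0.
Proof. by apply: (addrI (blie 0 y)); rewrite -blieDl !addr0. Qed.
Fact blie0r x : blie x 0 = 0.
Proof. by apply: (addrI (blie x 0)); rewrite -blieDr !addr0. Qed.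
Fact blieZl a x y : blie (a *: x) y = a *: blie x y.
Proof. by have := blie_linearl y a x 0; rewrite /= blie0l !addr0. Qed.
Fact blieZr a x y : blie x (a *: y) = a *: blie x y.
Proof. by have := blie_linearr x a y 0; rewrite /= blie0r !addr0. Qed.

End BasisBracket.

#[local] Opaque blie.

Section BasisAction.
Variables (K : fieldType) (B : choiceType) (V : lmodType K).
Variable c : B -> B -> {malg K[B]}.
Variable act : B -> V -> V.
Hypothesis act_linear : forall b, linear (act b).

Definition bact (x : {malg K[B]}) (v : V) : V := lext (act^~ v) x.

Fact bact_linearl v : linear (bact^~ v).
Proof. exact: lext_is_linear. Qed.

Fact bact_linearr x : linear (bact x).
Proof. exact: lext_linearf. Qed.

Fact bactDl x1 x2 v : bact (x1 + x2) v = bact x1 v + bact x2 v.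
Proof. by have := bact_linearl v 1 x1 x2; rewrite !scale1r. Qed.
Fact bact0l v : bact 0 v = 0.
Proof. by apply: (addrI (bact 0 v)); rewrite -bactDl !addr0. Qed.
Fact bactZl a x v : bact (a *: x) v = a *: bact x v.
Proof. by have := bact_linearl v a x 0; rewrite /= bact0l !addr0. Qed.
Fact bactDr x u v : bact x (u + v) = bact x u + bact x v.
Proof. by have := bact_linearr x 1 u v; rewrite !scale1r. Qed.
Fact bact0r x : bact x 0 = 0.
Proof. by apply: (addrI (bact x 0)); rewrite -bactDr !addr0. Qed.
Fact bactZr a x v : bact x (a *: v) = a *: bact x v.
Proof. by have := bact_linearr x a v 0; rewrite /= bact0r !addr0. Qed.

Fact bactB b v : bact << b >> v = act b v.
Proof. exact: lextB. Qed.

Hypothesis act_bracket : forall a b v,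
  bact (c a b) v = act a (act b v) - act b (act a v).

Fact bact_lie x y v : bact (blie c x y) v = bact x (bact y v) - bact y (bact x v).
Proof.
elim/malg_lind: x => [|x1 x2 h1 h2|a x h|a].
- by rewrite blie0l !bact0l bact0r subr0.
- by rewrite blieDl !bactDl h1 h2 bactDr opprD addrACA.
- by rewrite blieZl !bactZl h bactZr scalerBr.
elim/malg_lind: y => [|x1 x2 h1 h2|e y h|b].
- by rewrite blie0r !bact0l bact0r subr0.
- by rewrite blieDr !bactDl h1 h2 bactDr opprD addrACA.
- by rewrite blieZr !bactZl h bactZr scalerBr.
by rewrite blieB act_bracket !bactB.
Qed.

End BasisAction.

(** * The Lie algebras [L(0,0)] and [L~(0,0)] *)

Definition det2 (m n : int * int) : int := m.1 * n.2 - m.2 * n.1.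

Inductive L00_basis : Type := Tb of int * int | Eb of int * int.

Definition L00_basis_code (b : L00_basis) : int * int + int * int :=
  match b with Tb m => inl m | Eb m => inr m end.
Definition L00_basis_decode (s : int * int + int * int) : L00_basis :=
  match s with inl m => Tb m | inr m => Eb m end.
Fact L00_basis_codeK : cancel L00_basis_code L00_basis_decode.
Proof. by case. Qed.

HB.instance Definition _ := Equality.copy L00_basis (can_type L00_basis_codeK).
HB.instance Definition _ := Choice.copy L00_basis (can_type L00_basis_codeK).

Section L00.
Variable K : fieldType.

Definition L00_bracket (a b : L00_basis) : {malg K[L00_basis]} :=
  match a, b with
  | Tb m, Tb n => 0
  | Tb m, Eb n => - (det2 m n)%:~R *: << Tb (m + n) >>
  | Eb m, Tb n => (det2 n m)%:~R *: << Tb (n + m) >>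
  | Eb m, Eb n => - (det2 m n)%:~R *: << Eb (m + n) >>
  end.

Definition L00 : Type := {malg K[L00_basis]}.
HB.instance Definition _ := GRing.Lmodule.on L00.

Fact det2xx m : det2 m m = 0.
Proof. by rewrite /det2 mulrC subrr. Qed.
Fact det2C m n : det2 m n = - det2 n m.
Proof. by rewrite /det2; ring. Qed.

Fact L00_bracketxx a : L00_bracket a a = 0.
Proof. by case: a => m //=; rewrite det2xx oppr0 scale0r. Qed.
Fact L00_bracketC a b : L00_bracket a b = - L00_bracket b a.
Proof.
case: a b => m [] n /=; rewrite ?oppr0 -?scaleNr ?opprK //.
by rewrite det2C addrC -rmorphN opprK.
Qed.

Fact L00_bracketET m n :
  L00_bracket (Eb m) (Tb n) = - (det2 m n)%:~R *: << Tb (m + n) >>.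
Proof. by rewrite L00_bracketC /= -scaleNr opprK det2C addrC rmorphN. Qed.

Fact L00_bracketTT m n : L00_bracket (Tb m) (Tb n) = 0.
Proof. by []. Qed.
Fact L00_bracketTE m n :
  L00_bracket (Tb m) (Eb n) = - (det2 m n)%:~R *: << Tb (m + n) >>.
Proof. by []. Qed.
Fact L00_bracketEE m n :
  L00_bracket (Eb m) (Eb n) = - (det2 m n)%:~R *: << Eb (m + n) >>.
Proof. by []. Qed.

Let jacobi_coef (C : int * int -> L00_basis) m n p :
  - (det2 n p)%:~R *: (- (det2 m (n + p))%:~R *: (<< C (m + (n + p)) >> : {malg K[L00_basis]}))
  + - (det2 p m)%:~R *: (- (det2 n (p + m))%:~R *: (<< C (n + (p + m)) >> : {malg K[L00_basis]}))
  + - (det2 m n)%:~R *: (- (det2 p (m + n))%:~R *: (<< C (p + (m + n)) >> : {malg K[L00_basis]})) = 0.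
Proof.
have -> : n + (p + m) = m + (n + p) by rewrite addrA addrC.
have -> : p + (m + n) = m + (n + p) by rewrite addrC -addrA.
rewrite !scalerA -!scalerDl -!rmorphN -!rmorphM -!rmorphD.
by rewrite (_ : _ + _ = 0) ?rmorph0 ?scale0r // /det2 /=; ring.
Qed.

Fact L00_bracketJ a b d :
  blie L00_bracket << a >> (blie L00_bracket << b >> << d >>)
  + blie L00_bracket << b >> (blie L00_bracket << d >> << a >>)
  + blie L00_bracket << d >> (blie L00_bracket << a >> << b >>) = 0.
Proof.
rewrite !blieB; case: a => m; case: b => n; case: d => p;
  rewrite ?(L00_bracketTT, L00_bracketTE, L00_bracketET, L00_bracketEE);
  rewrite ?(blie0r, blieZr) ?blieB;
  rewrite ?(L00_bracketTT, L00_bracketTE, L00_bracketET, L00_bracketEE);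
  rewrite ?scaler0 ?addr0 //.
all: try exact: (jacobi_coef Tb).
all: try exact: (jacobi_coef Eb).
Qed.

HB.instance Definition _ := Lmodule_isLieAlgebra.Build K L00
  (blie_linearl L00_bracket) (blie_linearr L00_bracket)
  (basis_lie_alternating (blie_linearl L00_bracket)
     (blie_linearr L00_bracket)
     (fun a => etrans (blieB L00_bracket a a) (L00_bracketxx a))
     (fun a b => etrans (blieB L00_bracket a b)
        (etrans (L00_bracketC a b) (congr1 -%R (esym (blieB L00_bracket b a))))))
  (basis_lie_jacobi (blie_linearl L00_bracket) (blie_linearr L00_bracket)
     L00_bracketJ).

End L00.

(* [Db ord0] and [Db ord_max] are the degree derivations d_1 and d_2. *)
Inductive L00t_basis : Type := Lb of L00_basis | Db of 'I_2.

Definition L00t_basis_code (b : L00t_basis) : L00_basis + 'I_2 :=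
  match b with Lb a => inl a | Db i => inr i end.
Definition L00t_basis_decode (s : L00_basis + 'I_2) : L00t_basis :=
  match s with inl a => Lb a | inr i => Db i end.
Fact L00t_basis_codeK : cancel L00t_basis_code L00t_basis_decode.
Proof. by case. Qed.

HB.instance Definition _ := Equality.copy L00t_basis (can_type L00t_basis_codeK).
HB.instance Definition _ := Choice.copy L00t_basis (can_type L00t_basis_codeK).

Definition coord (i : 'I_2) (m : int * int) : int :=
  if i == ord0 then m.1 else m.2.

Definition L00_deg (i : 'I_2) (b : L00_basis) : int :=
  match b with Tb m => coord i m | Eb m => coord i m end.

Section L00t.
Variable K : fieldType.

Definition L00t : Type := {malg K[L00t_basis]}.
HB.instance Definition _ := GRing.Lmodule.on L00t.

Definition L00_embed : {malg K[L00_basis]} -> {malg K[L00t_basis]} :=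
  lext (fun b => << Lb b >>).
HB.instance Definition _ := GRing.Linear.on L00_embed.

Definition L00t_bracket (a b : L00t_basis) : {malg K[L00t_basis]} :=
  match a, b with
  | Lb a, Lb b => L00_embed (L00_bracket K a b)
  | Lb a, Db i => - (L00_deg i a)%:~R *: << Lb a >>
  | Db i, Lb b => (L00_deg i b)%:~R *: << Lb b >>
  | Db _, Db _ => 0
  end.

Fact L00t_bracketxx a : L00t_bracket a a = 0.
Proof. by case: a => a //=; rewrite L00_bracketxx linear0. Qed.

Fact L00t_bracketC a b : L00t_bracket a b = - L00t_bracket b a.
Proof.
case: a b => a [] b /=; rewrite ?oppr0 ?scaleNr ?opprK //.
by rewrite L00_bracketC linearN.
Qed.

Fact L00_embedB b : L00_embed << b >> = << Lb b >>.
Proof. exact: lextB. Qed.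
Fact L00_embedD x y : L00_embed (x + y) = L00_embed x + L00_embed y.
Proof. exact: linearD. Qed.
Fact L00_embedZ a x : L00_embed (a *: x) = a *: L00_embed x.
Proof. exact: linearZ_LR. Qed.
Fact L00_embed0 : L00_embed 0 = 0.
Proof. exact: linear0. Qed.
Fact L00_embedN x : L00_embed (- x) = - L00_embed x.
Proof. exact: linearN. Qed.

Fact L00_embed_lie x y : L00_embed (blie (L00_bracket K) x y) =
  blie L00t_bracket (L00_embed x) (L00_embed y).
Proof.
elim/malg_lind: x => [|x1 x2 h1 h2|a x h|a].
- by rewrite blie0l L00_embed0 blie0l.
- by rewrite blieDl !L00_embedD blieDl h1 h2.
- by rewrite blieZl !L00_embedZ blieZl h.
elim/malg_lind: y => [|x1 x2 h1 h2|d y h|b].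
- by rewrite L00_embed0 !blie0r L00_embed0.
- by rewrite blieDr !L00_embedD blieDr h1 h2.
- by rewrite blieZr !L00_embedZ blieZr h.
by rewrite blieB !L00_embedB blieB.
Qed.

(* [L00_bracket] is homogeneous for the two gradings. *)
Let L00_bracket_deg i a b :
  blie L00t_bracket << Db i >> (L00_embed (L00_bracket K a b)) =
  (L00_deg i a + L00_deg i b)%:~R *: L00_embed (L00_bracket K a b).
Proof.
have coordD m n : coord i (m + n) = coord i m + coord i n.
  by rewrite /coord; case: ifP.
case: a b => m [] n; rewrite ?(L00_bracketTT, L00_bracketTE, L00_bracketET,
  L00_bracketEE) ?L00_embed0 ?blie0r ?scaler0 // L00_embedZ L00_embedB
  blieZr blieB /= coordD !scalerA mulrC //.
Qed.

Let jacobi_deg i a b :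
  blie L00t_bracket << Db i >> (L00_embed (L00_bracket K a b)) +
  blie L00t_bracket << Lb a >> (- (L00_deg i b)%:~R *: << Lb b >>) +
  blie L00t_bracket << Lb b >> ((L00_deg i a)%:~R *: << Lb a >>) = 0.
Proof.
rewrite L00_bracket_deg !blieZr !blieB /= (L00_bracketC _ b a) L00_embedN scalerN.
by rewrite -scaleNr -!scalerDl rmorphD /= addrK subrr scale0r.
Qed.

Let bracketLL a b :
  L00t_bracket (Lb a) (Lb b) = L00_embed (L00_bracket K a b).
Proof. by []. Qed.
Let bracketLD a i :
  L00t_bracket (Lb a) (Db i) = - (L00_deg i a)%:~R *: << Lb a >>.
Proof. by []. Qed.
Let bracketDL i a :
  L00t_bracket (Db i) (Lb a) = (L00_deg i a)%:~R *: << Lb a >>.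
Proof. by []. Qed.
Let bracketDD i j : L00t_bracket (Db i) (Db j) = 0.
Proof. by []. Qed.

Let scale_comm (V : lmodType K) (x y : K) (v : V) :
  x *: (y *: v) + - y *: (x *: v) = 0.
Proof. by rewrite !scalerA -scalerDl mulNr mulrC subrr scale0r. Qed.

Fact L00t_bracketJ a b d :
  blie L00t_bracket << a >> (blie L00t_bracket << b >> << d >>)
  + blie L00t_bracket << b >> (blie L00t_bracket << d >> << a >>)
  + blie L00t_bracket << d >> (blie L00t_bracket << a >> << b >>) = 0.
Proof.
case: a => a; case: b => b; case: d => d;
  rewrite !blieB ?bracketLL ?bracketLD ?bracketDL ?bracketDD ?blie0r.
- have := L00_bracketJ K a b d; rewrite !blieB => /(congr1 L00_embed).
  by rewrite !L00_embedD L00_embed0 !L00_embed_lie !L00_embedB.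
- by rewrite addrC addrA; exact: jacobi_deg.
- by rewrite -addrA addrC; exact: jacobi_deg.
- by rewrite add0r !blieZr !blieB bracketDL !scale_comm.
- exact: jacobi_deg.
- by rewrite addr0 addrC !blieZr !blieB bracketDL !scale_comm.
- by rewrite addr0 !blieZr !blieB bracketDL !scale_comm.
- by rewrite !addr0.
Qed.

HB.instance Definition _ := Lmodule_isLieAlgebra.Build K L00t
  (blie_linearl L00t_bracket) (blie_linearr L00t_bracket)
  (basis_lie_alternating (blie_linearl L00t_bracket)
     (blie_linearr L00t_bracket)
     (fun a => etrans (blieB L00t_bracket a a) (L00t_bracketxx a))
     (fun a b => etrans (blieB L00t_bracket a b)
       (etrans (L00t_bracketC a b) (congr1 -%R (esym (blieB L00t_bracket b a))))))
  (basis_lie_jacobi (blie_linearl L00t_bracket) (blie_linearr L00t_bracket)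
     L00t_bracketJ).

Definition L00_incl : L00 K -> L00t := L00_embed.
Fact L00_incl_is_linear : linear L00_incl.
Proof. exact: lext_is_linear. Qed.
HB.instance Definition _ :=
  GRing.isLinear.Build K (L00 K) L00t *:%R L00_incl L00_incl_is_linear.

Fact L00_incl_morphism : lie_morphism L00_incl.
Proof. exact: L00_embed_lie. Qed.

End L00t.

(** * The modules [Omega(lambda, beta, b0, k)] *)

(* [monalg] has its own, different [{mpoly _[_]}]. *)
Local Notation "{ 'mpoly' T [ n ] }" := (mpoly.mpoly n T) : type_scope.

Definition nonzero (K : fieldType) : Type := {x : K | x != 0}.
HB.instance Definition _ (K : fieldType) := SubEquality.on (nonzero K).

Section Omega.
Variables (K : fieldType) (lam : nonzero K * nonzero K) (beta : K * K) (b0 k : K).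

Definition shift2 (m : int * int) (f : {mpoly K[2]}) : {mpoly K[2]} :=
  f \mPo [tuple 'X_i - ((coord i m)%:~R)%:MP | i < 2].

Definition lampow (m : int * int) : K := val lam.1 ^ m.1 * val lam.2 ^ m.2.

Definition Omega_basis_act (b : L00t_basis) (f : {mpoly K[2]}) : {mpoly K[2]} :=
  match b with
  | Lb (Tb m) => if m == 0 then b0 *: f else (lampow m * k) *: shift2 m f
  | Lb (Eb m) =>
      lampow m *: ((m.2%:~R *: ('X_ord0 + beta.1%:MP)
                    - m.1%:~R *: ('X_ord_max + beta.2%:MP)) * shift2 m f)
  | Db i => 'X_i * f
  end.

Fact lampowD m n : lampow (m + n) = lampow m * lampow n.
Proof.
rewrite /lampow /= !expfzDr ?(valP lam.1) ?(valP lam.2) //.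
by rewrite mulrACA.
Qed.

Fact shift2X m i : shift2 m 'X_i = 'X_i - ((coord i m)%:~R)%:MP.
Proof. by rewrite /shift2 comp_mpolyXU -tnth_nth tnth_mktuple. Qed.

Fact coordD i m n : coord i (m + n) = coord i m + coord i n.
Proof. by rewrite /coord; case: ifP. Qed.

Fact shift2D m n f : shift2 m (shift2 n f) = shift2 (m + n) f.
Proof.
rewrite {2 3}/shift2 (comp_mpolyEX f) (comp_mpolyEX f) /shift2 raddf_sum /=.
apply: eq_bigr => e _; rewrite comp_mpolyZ !comp_mpolyX rmorph_prod /=.
congr (_ *: _); apply: eq_bigr => i _; rewrite rmorphXn /= !tnth_mktuple.
rewrite rmorphB /= comp_mpolyC comp_mpolyXU -tnth_nth tnth_mktuple.
by rewrite coordD rmorphD mpolyCD /= opprD addrA.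
Qed.

Fact shift20 f : shift2 0 f = f.
Proof.
rewrite -[RHS]comp_mpoly_id; congr (_ \mPo _); apply: eq_from_tnth => i.
rewrite !tnth_mktuple /coord; case: ifP => _ /=; by rewrite mpolyC0 subr0.
Qed.

Fact shift2_linear m : linear (shift2 m).
Proof. by move=> a u v; rewrite /shift2 linearP. Qed.

Fact shift2Z m a f : shift2 m (a *: f) = a *: shift2 m f.
Proof. exact: comp_mpolyZ. Qed.

Fact shift2M m f g : shift2 m (f * g) = shift2 m f * shift2 m g.
Proof. exact: rmorphM. Qed.

Fact scale_linear (h : {mpoly K[2]} -> {mpoly K[2]}) c :
  linear h -> linear (fun f => c *: h f).
Proof. by move=> lin_h a u v; rewrite lin_h scalerDr !scalerA mulrC. Qed.

Fact mul_linear (h : {mpoly K[2]} -> {mpoly K[2]}) p :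
  linear h -> linear (fun f => p * h f).
Proof. by move=> lin_h a u v; rewrite lin_h mulrDr scalerAr. Qed.

Fact Omega_basis_act_linear b : linear (Omega_basis_act b).
Proof.
case: b => [[m|m]|i].
- rewrite /Omega_basis_act; case: (m == 0).
    exact: (@scale_linear id).
  by apply: scale_linear; apply: shift2_linear.
- by apply: scale_linear; apply: mul_linear; apply: shift2_linear.
- exact: (@mul_linear id).
Qed.

Let P (m : int * int) : {mpoly K[2]} :=
  m.2%:~R *: ('X_ord0 + beta.1%:MP) - m.1%:~R *: ('X_ord_max + beta.2%:MP).

Let PD m n : P (m + n) = P m + P n.
Proof. by rewrite /P /= !rmorphD /= !scalerDl opprD addrACA. Qed.

Let shift2P m n : shift2 m (P n) = P n - ((det2 m n)%:~R)%:MP.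
Proof.
have SB f g : shift2 m (f - g) = shift2 m f - shift2 m g by exact: comp_mpolyB.
have SD f g : shift2 m (f + g) = shift2 m f + shift2 m g by exact: comp_mpolyD.
have SC c : shift2 m c%:MP = c%:MP by exact: comp_mpolyC.
rewrite /P SB !shift2Z !SD !SC !shift2X /coord /= -!mul_mpolyC /det2.
rewrite rmorphB !rmorphM /= mpolyCB !mpolyCM; ring.
Qed.

Let actE m f : Omega_basis_act (Lb (Eb m)) f = lampow m *: (P m * shift2 m f).
Proof. by []. Qed.

Let actT m f : m != 0 ->
  Omega_basis_act (Lb (Tb m)) f = (lampow m * k) *: shift2 m f.
Proof. by rewrite /Omega_basis_act => /negbTE ->. Qed.

Let actT0 f : Omega_basis_act (Lb (Tb 0)) f = b0 *: f.
Proof. by rewrite /Omega_basis_act eqxx. Qed.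

Let det20 n : det2 0 n = 0. Proof. by rewrite /det2 /=; ring. Qed.
Let det2N n : det2 n (- n) = 0. Proof. by rewrite /det2 /=; ring. Qed.

Let act_degree i a f :
  Omega_basis_act (Lb a) ('X_i * f) =
  ('X_i - ((L00_deg i a)%:~R)%:MP) * Omega_basis_act (Lb a) f.
Proof.
case: a => m; last first.
  by rewrite !actE shift2M shift2X -!mul_mpolyC /=; ring.
have [->|m0] := eqVneq m 0; last first.
  by rewrite !actT // shift2M shift2X -!mul_mpolyC /=; ring.
rewrite !actT0 -!mul_mpolyC (_ : L00_deg i (Tb 0) = 0).
  by rewrite mpolyC0; ring.
by rewrite /= /coord; case: ifP.
Qed.

Let act_TE m n f :
  - (det2 m n)%:~R *: Omega_basis_act (Lb (Tb (m + n))) f =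
  Omega_basis_act (Lb (Tb m)) (Omega_basis_act (Lb (Eb n)) f)
  - Omega_basis_act (Lb (Eb n)) (Omega_basis_act (Lb (Tb m)) f).
Proof.
have [->|m0] := eqVneq m 0.
  rewrite det20 oppr0 scale0r !actT0 !actE shift2Z -!mul_mpolyC; ring.
rewrite !actE !(actT _ m0) !shift2Z !shift2M shift2P !shift2D [n + m]addrC.
have [mn0|mn0] := eqVneq (m + n) 0; last first.
  rewrite actT // lampowD -!mul_mpolyC !mpolyCM mpolyCN; ring.
have -> : det2 m n = 0 by rewrite -(addr0_eq mn0) det2N.
rewrite oppr0 scale0r mpolyC0 -!mul_mpolyC !mpolyCM; ring.
Qed.

Fact Omega_act_bracket a b f :
  bact Omega_basis_act (L00t_bracket K a b) f =
  Omega_basis_act a (Omega_basis_act b f)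
  - Omega_basis_act b (Omega_basis_act a f).
Proof.
case: a b => [a|i] [b|j]; rewrite /L00t_bracket.
- case: a b => m [] n; rewrite ?(L00_bracketTT, L00_bracketTE, L00_bracketET,
    L00_bracketEE) ?L00_embed0 ?L00_embedZ ?bact0l ?bactZl ?L00_embedB ?bactB.
  + have [->|m0] := eqVneq m 0; have [->|n0] := eqVneq n 0;
      rewrite !(actT0, actT) // ?shift2Z ?shift2D ?[n + m]addrC -!mul_mpolyC; ring.
  + exact: act_TE.
  + by rewrite -[RHS]opprB -act_TE det2C rmorphN /= opprK [m + n]addrC scaleNr opprK.
  + rewrite !actE !shift2Z !shift2M !shift2P !shift2D PD lampowD (det2C n m).
    rewrite rmorphN /= [n + m]addrC -!mul_mpolyC mpolyCM !mpolyCN; ring.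
- by rewrite bactZl bactB [Omega_basis_act (Db j) _]/= act_degree -mul_mpolyC
    mpolyCN /=; ring.
- by rewrite bactZl bactB [Omega_basis_act (Db i) _]/= act_degree -mul_mpolyC /=;
    ring.
- by rewrite bact0l /=; ring.
Qed.

Definition Omega : lieModule (L00t K) :=
  @LieModule K (L00t K) {mpoly K[2]} (bact Omega_basis_act)
    (bact_linearl Omega_basis_act)
    (bact_linearr Omega_basis_act_linear)
    (bact_lie Omega_basis_act_linear Omega_act_bracket).

Definition Omega_L00 : lieModule (L00 K) := restr (@L00_incl_morphism K) Omega.

End Omega.

(* Main.v *)
Require Import Defs.
From HB Require Import structures.
From mathcomp Require Import all_boot all_order all_algebra.
From mathcomp Require Import ring.
From mathcomp Require Import monalg mpoly.
From mathcomp Require Import reals complex.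

(** Write [x = 'X_0 + beta.1] and [y = 'X_1 + beta.2]: these two polynomials
    generate the polynomial ring, and [E(m)] is, up to the scalar
    [lambda^m], a translation by [m] followed by multiplication by the linear
    form [P m = m.2 x - m.1 y].  Carrying [x, y] to [x', y'] is a translation of
    the polynomial ring; it commutes with all the translations by [m], hence
    identifies, over [L(0,0)], modules that differ only in [beta].

    Conversely, let the linear bijection [phi] intertwine all the [E(m)].  Products of operators
    [E(m)] of total degree zero are multiplications by polynomials in which
    [lambda] has disappeared: [E(m) E(-m)] is multiplication by [- P m ^ 2]
    ([eop_opp]) and [E(m) E(n) E(-m-n)] gives a cubic ([eop_cycle]).  So
    [phi] carries multiplication by such a polynomial in [x, y] to
    multiplication by the same polynomial in [x', y'].  The squares give all
    products [P m * P n] by polarization, which is where 2 has to be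
    invertible.  Polynomials of even degree alone would still allow [phi] to
    scale the even and the odd part differently; the cubics
    [C = P m * P n * P (m + n)] exclude this: [C * P l] has even degree, so both
    [C] and [C * P l] are carried, and one cancels [C] ([carries_eform]).

    Therefore [phi f] is the translate of [f] times [phi 1]
    ([intertwiner_rigid]), and surjectivity makes [phi 1] a nonzero constant.
    Comparing the two modules on the vector 1 now gives [lambda], [b0] and
    [k].  If moreover [phi] commutes with multiplication by ['X_0] and ['X_1],
    the translation is trivial, that is [beta = beta']. *)

Set Implicit Arguments.
Unset Strict Implicit.
Unset Printing Implicit Defensive.

Import GRing.Theory Num.Theory.
Local Open Scope ring_scope.

Local Notation "{ 'mpoly' T [ n ] }" := (mpoly.mpoly n T) : type_scope.

(** * Translations of the polynomial ring *)

Section Translate.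
Variable K : fieldType.
Implicit Types (c d : 'I_2 -> K) (f : {mpoly K[2]}).

Definition translate c f : {mpoly K[2]} :=
  f \mPo [tuple 'X_i + (c i)%:MP | i < 2].

HB.instance Definition _ c := GRing.RMorphism.copy (translate c)
  (comp_mpoly [tuple 'X_i + (c i)%:MP | i < 2]).
HB.instance Definition _ c := GRing.Linear.copy (translate c)
  (comp_mpoly [tuple 'X_i + (c i)%:MP | i < 2]).

Lemma translateX c i : translate c 'X_i = 'X_i + (c i)%:MP.
Proof. by rewrite /translate comp_mpolyXU -tnth_nth tnth_mktuple. Qed.

Lemma translateC c a : translate c a%:MP = a%:MP.
Proof. exact: comp_mpolyC. Qed.

Lemma translateE c f :
  translate c f =
  \sum_(e <- msupp f) f@_e *: \prod_(i < 2) ('X_i + (c i)%:MP) ^+ e i.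
Proof.
rewrite /translate comp_mpolyE; apply: eq_bigr => e _; congr (_ *: _).
by apply: eq_bigr => i _; rewrite tnth_mktuple.
Qed.

Lemma translateD c d f :
  translate c (translate d f) = translate (fun i => c i + d i) f.
Proof.
rewrite (translateE d) [RHS]translateE linear_sum; apply: eq_bigr => e _.
rewrite linearZ_LR rmorph_prod; congr (_ *: _); apply: eq_bigr => i _.
rewrite rmorphXn rmorphD /= translateX translateC mpolyCD.
by rewrite addrA.
Qed.

Lemma eq_translate c d : c =1 d -> translate c =1 translate d.
Proof.
move=> cd f; rewrite !translateE; apply: eq_bigr => e _; congr (_ *: _).
by apply: eq_bigr => i _; rewrite cd.
Qed.

Lemma translateCA c d f :
  translate c (translate d f) = translate d (translate c f).
Proof. by rewrite !translateD; apply: eq_translate => i; rewrite addrC. Qed.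

Lemma translateK c : cancel (translate c) (translate (fun i => - c i)).
Proof.
move=> f; rewrite translateD -[RHS]comp_mpoly_id; congr (_ \mPo _).
by apply: eq_from_tnth => i; rewrite !tnth_mktuple addNr mpolyC0 addr0.
Qed.

Lemma translate_bij c : bijective (translate c).
Proof.
exists (translate (fun i => - c i)); first exact: translateK.
move=> f; rewrite -{2}(translateK (fun i => - c i) f).
by apply: eq_translate => i; rewrite opprK.
Qed.

Lemma shift2E m f : shift2 m f = translate (fun i => - (Defs.coord i m)%:~R) f.
Proof.
congr (_ \mPo _); apply: eq_from_tnth => i.
by rewrite !tnth_mktuple mpolyCN.
Qed.

Lemma shift2C m a : shift2 m a%:MP = a%:MP :> {mpoly K[2]}.
Proof. by rewrite shift2E translateC. Qed.

End Translate.

(** * Isomorphisms as maps commuting with the action of the basis *)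

Section IsoOnBasis.
Variables (K : fieldType) (lam lam' : nonzero K * nonzero K).
Variables (beta beta' : K * K) (b0 b0' k k' : K).

Local Notation act := (Omega_basis_act lam beta b0 k).
Local Notation act' := (Omega_basis_act lam' beta' b0' k').

(** Since [bact] is the linear extension of an action of the basis, a linear
    map intertwines it as soon as it intertwines each basis element. *)
Lemma bact_commute (V : lmodType K) (B : choiceType) (a a' : B -> V -> V)
    (phi : {linear V -> V}) (x : {malg K[B]}) (v : V) :
  (forall b u, phi (a b u) = a' b (phi u)) ->
  phi (bact a x v) = bact a' x (phi v).
Proof.
move=> h; rewrite /bact /lext linear_sum; apply: eq_bigr => b _.
by rewrite linearZ_LR h.
Qed.

Lemma Omega_isoP :
  lieModule_iso (Omega lam beta b0 k) (Omega lam' beta' b0' k') <->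
  exists phi : {linear {mpoly K[2]} -> {mpoly K[2]}}, bijective phi /\
    forall b f, phi (act b f) = act' b (phi f).
Proof.
split=> -[phi [bij h]]; exists phi; split=> //.
  move=> b f; have := h << b >> f.
  by rewrite /lieact /= !bactB.
by move=> x v; apply: bact_commute.
Qed.

Lemma Omega_L00_isoP :
  lieModule_iso (Omega_L00 lam beta b0 k) (Omega_L00 lam' beta' b0' k') <->
  exists phi : {linear {mpoly K[2]} -> {mpoly K[2]}}, bijective phi /\
    forall b f, phi (act (Lb b) f) = act' (Lb b) (phi f).
Proof.
split=> -[phi [bij h]]; exists phi; split=> //.
  move=> b f; have := h << b >> f.
  by rewrite /lieact /= /L00_incl L00_embedB !bactB.
move=> x v; rewrite /lieact /= /L00_incl.
elim/malg_lind: x => [|x y hx hy|a x hx|b].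
- by rewrite L00_embed0 !bact0l linear0.
- by rewrite L00_embedD !bactDl linearD hx hy.
- by rewrite L00_embedZ !bactZl linearZ_LR hx.
- by rewrite L00_embedB !bactB h.
Qed.

End IsoOnBasis.

(** * Multiplication operators carried across by an intertwiner *)

Section Rigidity.
Variables (K : fieldType) (lam lam' : nonzero K * nonzero K).
Variables (beta beta' : K * K).
Hypothesis two_neq0 : 2%:R != 0 :> K.

(** The linear form [m_2 x - m_1 y] in the shifted variables
    [x = 'X_0 + b.1] and [y = 'X_1 + b.2]. *)
Definition eform (b : K * K) (m : int * int) : {mpoly K[2]} :=
  m.2%:~R *: ('X_ord0 + b.1%:MP) - m.1%:~R *: ('X_ord_max + b.2%:MP).

(** The action of the basis vector [E(m)]. *)
Definition eop (l : nonzero K * nonzero K) (b : K * K) m f : {mpoly K[2]} :=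
  lampow l m *: (eform b m * shift2 m f).

Lemma eformD b m n : eform b (m + n) = eform b m + eform b n.
Proof. by rewrite /eform /= !rmorphD /= !scalerDl opprD addrACA. Qed.

Lemma eformN b m : eform b (- m) = - eform b m.
Proof. by rewrite /eform /= !rmorphN /= !scaleNr opprB opprK addrC. Qed.

Lemma shift2_eform b m n :
  shift2 m (eform b n) = eform b n - ((det2 m n)%:~R)%:MP.
Proof.
rewrite /eform {1}/shift2 raddfB /= !comp_mpolyZ !raddfD /= !comp_mpolyC.
rewrite -!/(shift2 m _) !shift2X /Defs.coord /= -!mul_mpolyC /det2.
rewrite !(rmorphN, rmorphM) /=; ring.
Qed.

Lemma lampowV (l : nonzero K * nonzero K) m : lampow l m * lampow l (- m) = 1.
Proof. by rewrite -lampowD subrr /lampow /= !expr0z mulr1. Qed.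

(** Both translations and both powers of [l] cancel.  No correction term
    appears because translating by [m] fixes the form of [- m]. *)
Lemma eop_opp l b m f : eop l b m (eop l b (- m) f) = - eform b m ^+ 2 * f.
Proof.
rewrite /eop shift2Z shift2M shift2D subrr shift20 shift2_eform eformN.
have -> : det2 m (- m) = 0 by rewrite /det2 /=; ring.
have := congr1 (@mpolyC 2 K) (lampowV l m); rewrite mpolyCM mpolyC1 => h.
by rewrite -!mul_mpolyC mpolyC0 -[RHS]mul1r -h; ring.
Qed.

(** The shortest product of total degree zero that multiplies by a polynomial
    of odd degree; the correction [det2 m n] comes from moving the translation
    by [m] across the form of [n]. *)
Lemma eop_cycle l b m n f :
  eop l b m (eop l b n (eop l b (- (m + n)) f)) =
  - (eform b m * (eform b n - ((det2 m n)%:~R)%:MP) * eform b (m + n)) * f.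
Proof.
rewrite /eop !(shift2Z, shift2M) !shift2D subrr shift20.
rewrite !shift2_eform eformN (_ : det2 (m + n) _ = 0); last first.
  by rewrite /det2 /=; ring.
have := congr1 (@mpolyC 2 K) (lampowV l (m + n)).
rewrite lampowD 2!mpolyCM mpolyC1 => h.
by rewrite -!mul_mpolyC mpolyC0 -[RHS]mul1r -h; ring.
Qed.

Section Carries.
Variable phi : {linear {mpoly K[2]} -> {mpoly K[2]}}.

(** This relation between polynomials is a subring of the square of the
    polynomial ring, so it can be propagated from generators. *)
Definition carries (p p' : {mpoly K[2]}) := forall f, phi (p * f) = p' * phi f.

Lemma carriesD p p' q q' :
  carries p p' -> carries q q' -> carries (p + q) (p' + q').
Proof. by move=> hp hq f; rewrite !mulrDl linearD hp hq. Qed.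

Lemma carriesM p p' q q' :
  carries p p' -> carries q q' -> carries (p * q) (p' * q').
Proof. by move=> hp hq f; rewrite -!mulrA hp hq. Qed.

Lemma carriesC a : carries a%:MP a%:MP.
Proof. by move=> f; rewrite !mul_mpolyC linearZ_LR. Qed.

Lemma carriesZ a p p' : carries p p' -> carries (a *: p) (a *: p').
Proof. by move=> h f; rewrite -!scalerAl linearZ_LR h. Qed.

Lemma carriesB p p' q q' :
  carries p p' -> carries q q' -> carries (p - q) (p' - q').
Proof. by move=> hp hq f; rewrite !mulrBl linearB hp hq. Qed.

Lemma carriesZK a p p' : a != 0 -> carries (a *: p) (a *: p') -> carries p p'.
Proof.
move=> a0 /(carriesZ a^-1); by rewrite !scalerA mulVf // !scale1r.
Qed.

Lemma carries_sum (I : Type) (r : seq I) (F F' : I -> {mpoly K[2]}) :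
  (forall i, carries (F i) (F' i)) ->
  carries (\sum_(i <- r) F i) (\sum_(i <- r) F' i).
Proof.
move=> h; apply: (big_ind2 carries) => [f||i _]; last exact: h.
  by rewrite !mul0r linear0.
by move=> *; apply: carriesD.
Qed.

Lemma carries_prod (I : Type) (r : seq I) (F F' : I -> {mpoly K[2]}) :
  (forall i, carries (F i) (F' i)) ->
  carries (\prod_(i <- r) F i) (\prod_(i <- r) F' i).
Proof.
move=> h; apply: (big_ind2 carries) => [f||i _]; last exact: h.
  by rewrite !mul1r.
by move=> *; apply: carriesM.
Qed.

Lemma carriesX p p' n : carries p p' -> carries (p ^+ n) (p' ^+ n).
Proof.
move=> h; elim: n => [f|n IHn]; first by rewrite !expr0 !mul1r.
by rewrite !exprS; apply: carriesM.
Qed.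

(** Carried polynomials may be divided out, since polynomials form an integral
    domain; this is how information in odd degree is recovered. *)
Lemma carries_cancel p p' q q' :
  q' != 0 -> carries q q' -> carries (q * p) (q' * p') -> carries p p'.
Proof.
move=> q0 hq hqp f; apply: (mulfI q0).
by rewrite -hq mulrA hqp mulrA.
Qed.

Lemma carries_translate c f :
  (forall i, carries 'X_i ('X_i + (c i)%:MP)) -> carries f (translate c f).
Proof.
move=> h; rewrite translateE {1}[f]mpolyE; apply: carries_sum => e.
apply: carriesZ; rewrite mpolyXE_id; apply: carries_prod => i.
exact: carriesX.
Qed.

Hypothesis phiE : forall m f, phi (eop lam beta m f) = eop lam' beta' m (phi f).

Local Notation carriesE f := (carries (f beta) (f beta')).

Lemma carries_eform2 m : carriesE (fun b => eform b m ^+ 2).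
Proof.
move=> f; have /eqP := phiE m (eop lam beta (- m) f).
by rewrite (phiE (- m)) !eop_opp !mulNr linearN eqr_opp => /eqP.
Qed.

(** Polarization of [carries_eform2]. *)
Lemma carries_eformM m n : carriesE (fun b => eform b m * eform b n).
Proof.
apply: (carriesZK two_neq0).
have E b : 2%:R *: (eform b m * eform b n) =
    eform b (m + n) ^+ 2 - eform b m ^+ 2 - eform b n ^+ 2.
  by rewrite eformD scaler_nat; ring.
by rewrite !E; apply: carriesB; [apply: carriesB|]; apply: carries_eform2.
Qed.

(** The lower-degree term of [eop_cycle] is a product of two forms, hence is
    already carried. *)
Lemma carries_eform3 m n :
  carriesE (fun b => eform b m * eform b n * eform b (m + n)).
Proof.
have E b : eform b m * eform b n * eform b (m + n) =
    eform b m * (eform b n - ((det2 m n)%:~R)%:MP) * eform b (m + n)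
    + (det2 m n)%:~R *: (eform b m * eform b (m + n)).
  by rewrite -mul_mpolyC; ring.
rewrite !E; apply: carriesD; last exact/carriesZ/carries_eformM.
move=> f; have /eqP := phiE m (eop lam beta n (eop lam beta (- (m + n)) f)).
rewrite (phiE n) (phiE (- (m + n))) !eop_cycle.
by rewrite !mulNr linearN eqr_opp => /eqP.
Qed.

Let e1 : int * int := (1, 0).
Let e2 : int * int := (0, 1).

Lemma eform3_neq0 (b : K * K) :
  eform b e1 * eform b e2 * eform b (e1 + e2) != 0.
Proof.
(* At this point x = 1 and y = -1, so the three forms take the values
   1, 1 and 2. *)
pose v (i : 'I_2) : K := if i == ord0 then 1 - b.1 else - 1 - b.2.
apply/negP => /eqP /(congr1 (meval v)).
rewrite /eform !(mevalM, mevalB, mevalZ, mevalD, mevalXU, mevalC, meval0) /v /=.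
move/eqP; apply/negP; rewrite (_ : _ * _ = 2%:R) //; ring.
Qed.

(** The cubic times the form of [m] splits into two products of two forms, so
    it is carried; then the cubic is cancelled. *)
Lemma carries_eform m : carriesE (fun b => eform b m).
Proof.
apply: (carries_cancel (eform3_neq0 _) (carries_eform3 e1 e2)).
have E b : eform b e1 * eform b e2 * eform b (e1 + e2) * eform b m =
  (eform b e1 * eform b e2) * (eform b (e1 + e2) * eform b m) by ring.
by rewrite !E; apply: carriesM; apply: carries_eformM.
Qed.

Definition beta_diff (i : 'I_2) : K :=
  if i == ord0 then beta'.1 - beta.1 else beta'.2 - beta.2.

Lemma carries_var i : carries 'X_i ('X_i + (beta_diff i)%:MP).
Proof.
have := carries_eform e1; have := carries_eform e2.
rewrite /eform /= !(mulr1z, mulr0z, scale1r, scale0r, subr0, sub0r).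
move=> h1 h2; rewrite /beta_diff; case: eqP => [->|i1].
  have := carriesB h1 (carriesC beta.1).
  by rewrite addrK -addrA -mpolyCB.
have -> : i = ord_max.
  by case: i i1 => -[|[|//]] lti i1; [case: i1|]; apply: val_inj.
have := carriesB (carriesZ (-1) h2) (carriesC beta.2).
by rewrite !scaleN1r !opprK addrK -addrA -mpolyCB.
Qed.

Lemma intertwiner_rigid f : phi f = translate beta_diff f * phi 1.
Proof. by rewrite -(carries_translate f carries_var) mulr1. Qed.

(** A preimage of 1 under [phi] exhibits [phi 1] as an invertible
    polynomial. *)
Lemma intertwiner1_const : bijective phi -> exists2 c, c != 0 & phi 1 = c%:MP.
Proof.
case=> psi _ psiK; have := psiK 1; rewrite intertwiner_rigid => /mpoly_intro_unit.
by rewrite /= => /andP[/eqP phi1 c1]; exists (phi 1)@_0%MM; rewrite // -unitfE.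
Qed.

(** Apply [phi] to [E(m) 1]: constants are invariant under translation, so the
    two sides differ only in their powers of [lambda]. *)
Lemma intertwiner_lampow m :
  bijective phi -> eform beta' m != 0 -> lampow lam m = lampow lam' m.
Proof.
move=> /intertwiner1_const[c c0 phi1] P0; have := phiE m 1.
rewrite /eop linearZ_LR carries_eform phi1 -mpolyC1 !shift2C mpolyC1 phi1.
rewrite -!mul_mpolyC => /mulIf e; apply/eqP; rewrite -(mpolyC_eq 2); apply/eqP.
by apply: e; rewrite mulf_neq0 // mpolyC_eq0.
Qed.

Lemma intertwiner_lam : bijective phi -> lam = lam'.
Proof.
move=> bij; have := eform3_neq0 beta'; rewrite !mulf_eq0 !negb_or -andbA.
case/and3P => /(intertwiner_lampow bij) h1 /(intertwiner_lampow bij) h2 _.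
move: h1 h2; rewrite /lampow /= !(expr1z, expr0z, mulr1, mul1r).
by case: lam lam' => [x y] [x' y'] /= /val_inj-> /val_inj->.
Qed.

End Carries.

End Rigidity.

(** * The isomorphism classes *)

Section Classification.
Variables (K : fieldType) (lam lam' : nonzero K * nonzero K).
Variables (beta beta' : K * K) (b0 b0' k k' : K).
Hypothesis two_neq0 : 2%:R != 0 :> K.

Lemma Omega_L00_iso_params :
  lieModule_iso (Omega_L00 lam beta b0 k) (Omega_L00 lam' beta' b0' k') ->
  [/\ lam = lam', b0 = b0' & k = k'].
Proof.
case/Omega_L00_isoP => phi [bij h].
have phiE m f : phi (eop lam beta m f) = eop lam' beta' m (phi f).
  exact: h (Eb m) f.
have [c c0 phi1] := intertwiner1_const two_neq0 phiE bij.
have scaleI a a' : a *: phi 1 = a' *: phi 1 -> a = a'.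
  rewrite phi1 -!mul_mpolyC -!mpolyCM => /eqP.
  by rewrite mpolyC_eq => /eqP /(mulIf c0).
have lamE := intertwiner_lam two_neq0 phiE bij; split=> //.
  apply: scaleI; have := h (Tb 0) 1.
  by rewrite /= linearZ_LR.
have := h (Tb (1, 0)) 1; rewrite /= linearZ_LR -lamE {1}/shift2 rmorph1.
rewrite {2}phi1 shift2C -phi1 => /scaleI; apply: mulfI.
by rewrite mulf_neq0 // expfz_neq0 // (valP lam.1, valP lam.2).
Qed.

(** The translation that maps [x, y] to their analogues for [beta'] commutes
    with the translations by [m]. *)
Lemma Omega_L00_iso_beta :
  lieModule_iso (Omega_L00 lam beta b0 k) (Omega_L00 lam beta' b0 k).
Proof.
apply/Omega_L00_isoP; exists (translate (beta_diff beta beta')).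
split; first exact: translate_bij.
have shiftC m f : translate (beta_diff beta beta') (shift2 m f) =
    shift2 m (translate (beta_diff beta beta') f).
  by rewrite !shift2E translateCA.
move=> [m|m] f /=.
  by case: ifP => _; rewrite linearZ_LR //= shiftC.
rewrite linearZ_LR rmorphM rmorphB /= !linearZ_LR /= !rmorphD /= shiftC.
by rewrite !translateX !translateC -!addrA -!mpolyCD /beta_diff /= !subrK.
Qed.

Lemma Omega_iso_params :
  lieModule_iso (Omega lam beta b0 k) (Omega lam' beta' b0' k') ->
  [/\ lam = lam', beta = beta', b0 = b0' & k = k'].
Proof.
move=> iso; have isoL : lieModule_iso (Omega_L00 lam beta b0 k)
    (Omega_L00 lam' beta' b0' k').
  by case: iso => phi [bij h]; exists phi; split=> // x v; apply: h.
have [-> -> ->] := Omega_L00_iso_params isoL; split=> //.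
case/Omega_isoP: iso => phi [bij h].
have phiE m f : phi (eop lam beta m f) = eop lam' beta' m (phi f).
  exact: h (Lb (Eb m)) f.
have [c c0 phi1] := intertwiner1_const two_neq0 phiE bij.
(* phi commutes with multiplication by 'X_i and also carries it to
   multiplication by 'X_i plus a constant, so that constant is zero. *)
have diff0 i : beta_diff beta beta' i = 0.
  have := h (Db i) 1; rewrite /= (carries_var two_neq0 phiE) mulrDl => /eqP.
  rewrite -subr_eq0 addrAC subrr add0r phi1 -mpolyCM mpolyC_eq0 mulf_eq0.
  by rewrite (negbTE c0) orbF => /eqP.
have := diff0 ord_max; have := diff0 ord0; rewrite /beta_diff /= => /eqP.
rewrite subr_eq0 => /eqP e1 /eqP; rewrite subr_eq0 => /eqP e2.
by apply/esym; case: beta beta' e1 e2 => [x y] [x' y'] /= -> ->.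
Qed.

End Classification.

Theorem theorem2p10 (R : realType)
    (lam lam' : nonzero R[i] * nonzero R[i]) (beta beta' : R[i] * R[i])
    (b0 b0' k k' : R[i]) :
  (lieModule_iso (Omega_L00 lam beta b0 k) (Omega_L00 lam' beta' b0' k')
     <-> [/\ lam = lam', b0 = b0' & k = k']) /\
  (lieModule_iso (Omega lam beta b0 k) (Omega lam' beta' b0' k')
     <-> [/\ lam = lam', beta = beta', b0 = b0' & k = k']).
Proof.
have two_neq0 : 2%:R != 0 :> R[i] by rewrite pnatr_eq0.
split; split.
- exact: Omega_L00_iso_params.
- by case=> -> -> ->; apply: Omega_L00_iso_beta.
- exact: Omega_iso_params.
- by case=> -> -> -> ->; exists idfun; split=> //; exists idfun.
Qed.
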